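(* Let $\mathcal{F}$ be a singular foliation at $(\mathbb{C}^2,p)$. Then: (1) $\chi_p(\mathcal{F})\geq 0$; (2) if $\mathcal{F}$ is of second type then $\chi_p(\mathcal{F})=0$; (3) if $\chi_p(\mathcal{F})=0$, then either $\mathcal{F}$ has algebraic multiplicity $1$ at $p$ or $\mathcal{F}$ is of second type; (4) if $\nu_p(\mathcal{F})>1$, then $\chi_p(\mathcal{F})=0$ if and only if $\mathcal{F}$ is of second type.
   Context: **Foliations.** A singular foliation $\mathcal F$ at $(\mathbb C^2,p)$ is given, in coordinates $(x,y)$ centered at $p$, by a (holomorphic or formal) 1-form $\omega=P\,dx+Q\,dy$ with $P,Q\in\mathbb C[[x,y]]$ relatively prime and vanishing at $p$, or by the dual vector field $v=-Q\,\partial_x+P\,\partial_y$. Its algebraic multiplicity $\nu_p(\mathcal F)$ is the minimum of the orders of $P,Q$ at $p$. **Reduction of singularities.** A singularity is reduced if the linear part of $v$ is non-zero with eigenvalues $\lambda_1,\lambda_2$ such that either $\lambda_1\lambda_2\ne0$ and $\lambda_1/\lambda_2\notin\mathbb Q^+$, or $\lambda_1\neq0=\lambda_2$ (saddle-node). A saddle-node has formal normal form $x^{k+1}dy-y(1+\lambda x^k)dx$, $k\ge1$; $\{y=0\}$ is its weak and $\{x=0\}$ its strong separatrix. Let $\pi:(\tilde X,\mathcal D)\to(\mathbb C^2,p)$ be a fixed reduction process of singularities (Seidenberg) with strict transform $\tilde{\mathcal F}$. **Second type, tangency excess, $\chi$-number.** A saddle-node of $\tilde{\mathcal F}$ is tangent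 if its weak separatrix is contained in $\mathcal D$. $\mathcal F$ is of second type if no tangent saddle-nodes appear in its reduction process. The tangency excess is $\xi_p(\mathcal F)=0$ if $p$ is reduced, and otherwise $\xi_p(\mathcal F)=\sum_{q}\nu(D_q)(\mathrm{Ind}_q(\tilde{\mathcal F},\tilde B)-1)$, sum over the tangent saddle-nodes $q$ on $\mathcal D$, where $\tilde B$ is the weak separatrix at $q$, $D_q$ the component of $\mathcal D$ containing $\tilde B$, $\nu(D_q)$ the algebraic multiplicity of a curve at $p$ whose strict transform meets $D_q$ transversally outside corners, and $\mathrm{Ind}_q(\tilde{\mathcal F},\tilde B)=k+1$ for $k$ as in the formal normal form above. The set $\mathcal I_p(\mathcal F)$ of infinitely near points is defined recursively along the reduction process: at a point $q$ of an intermediate stage with divisor $\mathcal D$ and transformed foliation $\tilde{\mathcal F}$, if $\tilde{\mathcal F}$ is reduced at $q$ then $\mathcal I_q(\tilde{\mathcal F})=\{q\}$; if $q$ is $\mathcal D$-singular (i.e. $\tilde{\mathcal F}$ is singular at $q$, or regular but its leaf through $q$ does not have normal crossings with $\mathcal D$) and not reduced, blow up $q$, let $q_1,\dots,q_\ell$ be the singular points relative to the new divisor lying on the new component, and set $\mathcal I_q(\tilde{\mathcal F})=\{q\}\cup\mathcal I_{q_1}\cup\dots\cup\mathcal I_{q_\ell}$. For $q\in\mathcal I_p(\mathcal F)$, $\nu_q(\mathcal F)$ and $\xi_q(\mathcal F)$ denote the invariants of the strict transform of $\mathcal F$ at $q$. The $\chi$-number is $$\chi_p(\mathcal F)=\Big(\sum_{q\in\mathcal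 I_p(\mathcal F)}\nu_q(\mathcal F)\,\xi_q(\mathcal F)\Big)-\xi_p(\mathcal F).$$ *)

(* Defs.v *)
From HB Require Import structures.
From mathcomp Require Import all_boot all_order all_algebra.
From mathcomp Require Import boolp classical_sets functions cardinality fsbigop.
From mathcomp Require Import reals.
From mathcomp Require Import complex.
Set Implicit Arguments.
Unset Strict Implicit.
Unset Printing Implicit Defensive.
Import Order.TTheory GRing.Theory Num.Theory.
Local Open Scope classical_set_scope.
Local Open Scope ring_scope.

(* A record rather than a bare function type: [nat -> A] already carries the
   pointwise ring structure. *)
Record fps (A : Type) := Fps { coef : nat -> A }.

Section FpsRing.
Variable A : comNzRingType.
Implicit Types a b c : fps A.

HB.instance Definition _ := gen_eqMixin (fps A).
HB.instance Definition _ := gen_choiceMixin (fps A).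

Lemma fpsP a b : (forall n, coef a n = coef b n) -> a = b.
Proof. by case: a b => [f] [g] /= h; congr Fps; apply/funext. Qed.

Definition fps_zero : fps A := Fps (fun _ => 0).
Definition fps_one : fps A := Fps (fun n => (n == 0%N)%:R).
Definition fps_opp a : fps A := Fps (fun n => - coef a n).
Definition fps_add a b : fps A := Fps (fun n => coef a n + coef b n).
Definition fps_mul a b : fps A :=
  Fps (fun n => \sum_(j < n.+1) coef a j * coef b (n - j)%N).

Fact fps_addA : associative fps_add.
Proof. by move=> a b c; apply: fpsP => n /=; rewrite addrA. Qed.
Fact fps_addC : commutative fps_add.
Proof. by move=> a b; apply: fpsP => n /=; rewrite addrC. Qed.
Fact fps_add0 : left_id fps_zero fps_add.
Proof. by move=> a; apply: fpsP => n /=; rewrite add0r. Qed.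
Fact fps_addN : left_inverse fps_zero fps_opp fps_add.
Proof. by move=> a; apply: fpsP => n /=; rewrite addNr. Qed.

HB.instance Definition _ :=
  GRing.isZmodule.Build (fps A) fps_addA fps_addC fps_add0 fps_addN.

Let trunc n a : {poly A} := \poly_(i < n.+1) coef a i.

Let coef_trunc n a i : (i <= n)%N -> (trunc n a)`_i = coef a i.
Proof. by move=> le_in; rewrite coef_poly ltnS le_in. Qed.

Let mul_trunc n a b i : (i <= n)%N ->
  coef (fps_mul a b) i = (trunc n a * trunc n b)`_i.
Proof.
move=> le_in; rewrite coefM /=; apply: eq_bigr => j _.
have le_jn : (j <= n)%N by apply: leq_trans le_in; rewrite -ltnS.
by rewrite !coef_trunc // (leq_trans (leq_subr _ _) le_in).
Qed.

Fact fps_mulA : associative fps_mul.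
Proof.
move=> a b c; apply: fpsP => n.
have -> : coef (fps_mul a (fps_mul b c)) n =
          (trunc n a * (trunc n b * trunc n c))`_n.
  rewrite coefM; apply: eq_bigr => j _.
  have le_jn : (j <= n)%N by rewrite -ltnS.
  by rewrite (coef_trunc a le_jn) -(mul_trunc b c (leq_subr j n)).
rewrite mulrA coefM; apply: eq_bigr => j _.
have le_jn : (j <= n)%N by rewrite -ltnS.
by rewrite (coef_trunc c (leq_subr j n)) -(mul_trunc a b le_jn).
Qed.
Fact fps_mulC : commutative fps_mul.
Proof.
by move=> a b; apply: fpsP => n; rewrite !(mul_trunc _ _ (leqnn n)) mulrC.
Qed.
Fact fps_mul1 : left_id fps_one fps_mul.
Proof.
move=> a; apply: fpsP => n /=.
by rewrite big_ord_recl /= mul1r subn0 big1 ?addr0 // => i _; rewrite mul0r.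
Qed.
Fact fps_mulDl : left_distributive fps_mul fps_add.
Proof.
move=> a b c; apply: fpsP => n /=.
by rewrite -big_split; apply: eq_bigr => i _; rewrite mulrDl.
Qed.
Fact fps_oner_neq0 : fps_one != fps_zero.
Proof.
by apply/eqP => /(congr1 (fun a => coef a 0)) /= /eqP; rewrite oner_eq0.
Qed.

HB.instance Definition _ := GRing.Zmodule_isComNzRing.Build (fps A)
  fps_mulA fps_mulC fps_mul1 fps_mulDl fps_oner_neq0.

Definition fps_const (x : A) : fps A := Fps (fun n => x *+ (n == 0%N)).
Definition fps_var : fps A := Fps (fun n => (n == 1%N)%:R).

Definition fps_dvd a b : Prop := exists c, b = a * c.
Definition fps_unit a : Prop := exists b, a * b = 1.

End FpsRing.

(* Least element of a set of natural numbers (0 if the set is empty). *)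
Definition nat_least (S : set nat) : nat :=
  xget 0%N [set n | S n /\ forall m, S m -> (n <= m)%N].

Section Foliations.
Variable K : fieldType.

(* K[[x,y]] := K[[x]][[y]] *)
Local Notation fps2 := (fps (fps K)).

(* the coefficient of x^i y^j *)
Definition coef2 (f : fps2) (i j : nat) : K := coef (coef f j) i.
Definition Fps2 (u : nat -> nat -> K) : fps2 := Fps (fun j => Fps (fun i => u i j)).

Definition cst (c : K) : fps2 := fps_const (fps_const c).
Definition varx : fps2 := fps_const (fps_var K).
Definition vary : fps2 := fps_var (fps K).

Definition derx (f : fps2) : fps2 := Fps2 (fun i j => coef2 f i.+1 j *+ i.+1).
Definition dery (f : fps2) : fps2 := Fps2 (fun i j => coef2 f i j.+1 *+ j.+1).

(* f(g, h), for g and h without constant term: then g^k h^l has no term of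
   degree < k + l, so that the sums below contain all the contributions. *)
Definition fps2_comp (f g h : fps2) : fps2 :=
  Fps2 (fun i j => \sum_(k < (i + j).+1) \sum_(l < (i + j).+1)
                     coef2 f k l * coef2 (g ^+ k * h ^+ l) i j).

(* (P, Q) stands for P dx + Q dy *)
Definition oneform := (fps2 * fps2)%type.

(* (f, g) stands for the map (x, y) |-> (f(x, y), g(x, y)) *)
Definition formal_map := (fps2 * fps2)%type.

Definition pullback (phi : formal_map) (w : oneform) : oneform :=
  let P := fps2_comp w.1 phi.1 phi.2 in
  let Q := fps2_comp w.2 phi.1 phi.2 in
  (P * derx phi.1 + Q * derx phi.2, P * dery phi.1 + Q * dery phi.2).

Definition coordinate_change (phi : formal_map) : Prop :=
  [/\ coef2 phi.1 0 0 = 0, coef2 phi.2 0 0 = 0 &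
      coef2 phi.1 1 0 * coef2 phi.2 0 1 - coef2 phi.1 0 1 * coef2 phi.2 1 0 != 0].

Definition relatively_prime (P Q : fps2) : Prop :=
  forall g, fps_dvd g P -> fps_dvd g Q -> fps_unit g.

Definition singular (w : oneform) : Prop :=
  coef2 w.1 0 0 = 0 /\ coef2 w.2 0 0 = 0.

Definition singular_foliation (w : oneform) : Prop :=
  relatively_prime w.1 w.2 /\ singular w.

(* The minimum of the orders of P and Q, the order of 0 being infinite. *)
Definition alg_mult (w : oneform) : nat :=
  nat_least [set n | exists i j, (i + j = n)%N /\
                       (coef2 w.1 i j != 0 \/ coef2 w.2 i j != 0)].

(* Jacobian matrix at the origin of the dual vector field -Q d/dx + P d/dy. *)
Definition linear_part (w : oneform) : 'M[K]_2 :=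
  \matrix_(i < 2, j < 2)
    let f := if i == 0 then - w.2 else w.1 in
    if j == 0 then coef2 f 1 0 else coef2 f 0 1.

Definition has_eigenvalues (M : 'M[K]_2) (l1 l2 : K) : Prop :=
  char_poly M = ('X - l1%:P) * ('X - l2%:P).

Definition reduced (w : oneform) : Prop :=
  [/\ singular w, linear_part w != 0 &
      exists l1 l2, has_eigenvalues (linear_part w) l1 l2 /\
        ([/\ l1 != 0, l2 != 0 & ~ exists r : rat, 0 < r /\ l1 / l2 = ratr r] \/
         (l1 != 0 /\ l2 = 0))].

Definition saddle_node (w : oneform) : Prop :=
  singular w /\ exists2 l, l != 0 & has_eigenvalues (linear_part w) l 0.

(* x^(k+1) dy - y (1 + lambda x^k) dx *)
Definition saddle_node_model (k : nat) (lambda : K) : oneform :=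
  (- (vary * (1 + cst lambda * varx ^+ k)), varx ^+ k.+1).

(* Up to a unit, w becomes the model in the coordinates phi. *)
Definition normalizes (w : oneform) (k : nat) (phi : formal_map) : Prop :=
  [/\ (0 < k)%N, coordinate_change phi &
      exists u lambda, fps_unit u /\
        pullback phi w = (u * (saddle_node_model k lambda).1,
                          u * (saddle_node_model k lambda).2)].

(* The coordinate axes, which carry the divisor at every infinitely near
    point: [AxisX] is the curve {x = 0} and [AxisY] is the curve {y = 0}. *)
Inductive axis := AxisX | AxisY.

Definition axis_eq (b : axis) : fps2 := if b is AxisX then varx else vary.

(* The weak separatrix, that is the image under phi of {y = 0}, is the axis b:
   the equation of b, pulled back by phi, is divisible by y. *)
Definition weak_separatrix (w : oneform) (b : axis) : Prop :=
  saddle_node w /\ exists k phi, normalizes w k phi /\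
    fps_dvd vary (if b is AxisX then phi.1 else phi.2).

(* Ind_q of a saddle-node along its weak separatrix *)
Definition weak_index (w : oneform) : nat :=
  xget 0%N [set n | exists k phi, normalizes w k phi /\ n = k.+1].

(* A point of the exceptional line: [Some c] is the direction y = c x and
   [None] is the direction x = 0. *)
Definition direction := option K.

(* [:: e_n; ...; e_1] is the point of direction e_n on the exceptional line of
   the blow-up of [:: e_(n-1); ...; e_1]; the base point p is [::]. *)
Definition point := seq direction.

(* The blow-up, in the chart centred at the point e of the exceptional line,
   whose equation is x = 0 (for [Some c]) or y = 0 (for [None]). *)
Definition blowup (e : direction) : formal_map :=
  if e is Some c then (varx, varx * (vary + cst c)) else (varx * vary, vary).

(* The pullback by the blow-up, divided by the largest possible power of the
   equation of the exceptional line. *)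
Definition strict_transform (w : oneform) (e : direction) : oneform :=
  let eta := pullback (blowup e) w in
  if e is Some _ then
    let m := nat_least [set m | exists j, coef2 eta.1 m j != 0 \/
                                          coef2 eta.2 m j != 0] in
    (Fps2 (fun i j => coef2 eta.1 (i + m) j), Fps2 (fun i j => coef2 eta.2 (i + m) j))
  else
    let m := nat_least [set m | exists i, coef2 eta.1 i m != 0 \/
                                          coef2 eta.2 i m != 0] in
    (Fps2 (fun i j => coef2 eta.1 i (j + m)), Fps2 (fun i j => coef2 eta.2 i (j + m))).

Fixpoint foliation_at (w : oneform) (q : point) : oneform :=
  if q is e :: q' then strict_transform (foliation_at w q') e else w.

(* The germ at q of the exceptional divisor over p: for each axis, [Some r] if
   it is the strict transform of the exceptional line of the blow-up of r, and
   [None] if it is not contained in the divisor. *)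
Fixpoint divisor (q : point) (b : axis) : option point :=
  match q, b with
  | [::], _ => None
  | Some c :: q', AxisX => Some q'
  | Some c :: q', AxisY => if c == 0 then divisor q' AxisY else None
  | None :: q', AxisX => divisor q' AxisX
  | None :: q', AxisY => Some q'
  end.

Definition in_divisor (q : point) (b : axis) : bool := isSome (divisor q b).

Definition corner (q : point) : bool := in_divisor q AxisX && in_divisor q AxisY.

(* At a regular point, the leaf is the axis b / is transverse to the axis b. *)
Definition leaf_is_axis (w : oneform) (b : axis) : Prop :=
  if b is AxisX then fps_dvd varx w.2 else fps_dvd vary w.1.
Definition leaf_transverse (w : oneform) (b : axis) : Prop :=
  if b is AxisX then coef2 w.2 0 0 != 0 else coef2 w.1 0 0 != 0.

(* The leaf and the components of the divisor through q are pairwise equal or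
   transverse, and there are at most two distinct curves among them. *)
Definition leaf_normal_crossings (w : oneform) (q : point) : Prop :=
  (forall b, in_divisor q b -> leaf_is_axis w b \/ leaf_transverse w b) /\
  (corner q -> exists b, leaf_is_axis w b).

Definition D_singular (w : oneform) (q : point) : Prop :=
  let wq := foliation_at w q in
  singular wq \/ (~ singular wq /\ ~ leaf_normal_crossings wq q).

(* The set I_p(F) *)
Inductive infinitely_near (w : oneform) : point -> Prop :=
| Near_base : D_singular w [::] -> infinitely_near w [::]
| Near_blowup e q : infinitely_near w q -> ~ reduced (foliation_at w q) ->
    D_singular w (e :: q) -> infinitely_near w (e :: q).

Definition is_center (w : oneform) (q : point) : Prop :=
  infinitely_near w q /\ ~ reduced (foliation_at w q).

(* Finitely many blow-ups, centered at non-reduced singular points relative to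
   the divisor, after which all the points that are singular relative to the
   divisor are reduced. Such a process exists by Seidenberg's theorem; up to the
   order of the blow-ups it is determined by w. *)
Record reduction_process (w : oneform) := ReductionProcess {
  centers : seq point;
  centers_closed : forall e q, e :: q \in centers -> q \in centers;
  centers_nonreduced : forall q, q \in centers ->
    D_singular w q /\ ~ reduced (foliation_at w q);
  final_reduced : forall q, q \notin centers ->
    (q = [::] \/ behead q \in centers) ->
    D_singular w q -> reduced (foliation_at w q)
}.

(* a parametrized curve t |-> (a(t), b(t)) *)
Definition curve := (fps K * fps K)%type.

Definition curve_blowdown (e : direction) (g : curve) : curve :=
  if e is Some c then (g.1, g.1 * (g.2 + fps_const c)) else (g.1 * g.2, g.2).

(* the image at p of a curve at q *)
Fixpoint curve_at_base (q : point) (g : curve) : curve :=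
  if q is e :: q' then curve_at_base q' (curve_blowdown e g) else g.

Definition curve_mult (g : curve) : nat :=
  nat_least [set n | coef g.1 n != 0 \/ coef g.2 n != 0].

(* g is a curve at the point e of the exceptional line, transverse to it. *)
Definition transverse_curve (e : direction) (g : curve) : Prop :=
  [/\ coef g.1 0 = 0, coef g.2 0 = 0 &
      if e is Some _ then coef g.1 1 != 0 else coef g.2 1 != 0].

(* nu(D_r), for D_r the component created by the blow-up of r. The points e :: r
   that are blown up later on are no longer points of D_r in the final
   divisor (they are replaced by corners). *)
Definition component_mult (w : oneform) (r : point) : nat :=
  xget 0%N [set n | exists e g,
    [/\ ~~ corner (e :: r), ~ is_center w (e :: r), transverse_curve e g &
        n = curve_mult (curve_at_base (e :: r) g)]].

(* q is a tangent saddle-node of the reduced foliation, its weak separatrix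
   being contained in the component created by the blow-up of r. *)
Definition tangent_along (w : oneform) (q r : point) : Prop :=
  [/\ infinitely_near w q, reduced (foliation_at w q) &
      exists b, divisor q b = Some r /\ weak_separatrix (foliation_at w q) b].

Definition tangent_saddle_node (w : oneform) (q : point) : Prop :=
  exists r, tangent_along w q r.

Definition second_type (w : oneform) : Prop :=
  forall q, ~ tangent_saddle_node w q.

Definition weak_component (w : oneform) (q : point) : point :=
  xget [::] [set r | tangent_along w q r].

Definition tangency_excess (w : oneform) : nat :=
  if `[< reduced w >] then 0%N else
  \big[addn/0%N]_(q \in [set q | tangent_saddle_node w q])
     (component_mult w (weak_component w q) *
      (weak_index (foliation_at w q) - 1))%N.

Definition chi_number (w : oneform) : int :=
  (\big[addn/0%N]_(q \in [set q | infinitely_near w q])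
     (alg_mult (foliation_at w q) * tangency_excess (foliation_at w q))%N)%:Z
  - (tangency_excess w)%:Z.

End Foliations.

(* Main.v *)
From mathcomp Require Import all_boot all_order all_algebra.
From mathcomp Require Import boolp classical_sets functions cardinality fsbigop.
From mathcomp Require Import reals.
From mathcomp Require Import complex.
Require Import Defs.
Import Order.TTheory GRing.Theory Num.Theory.
Local Open Scope ring_scope.
Set Implicit Arguments.
Unset Strict Implicit.
Unset Printing Implicit Defensive.

(** The base point [p] belongs to [I_p(F)], so that
<<
    chi_p = (nu_p - 1) xi_p + sum_(q in I_p, q <> p) nu_q xi_q,
>>
    where every number on the right is a natural number and [nu_p >= 1]
    ([chi_numberE]); this gives [chi_p >= 0].

    If [F] is of second type, then all the [xi_q] vanish, since a tangent
    saddle-node of the germ of [F] at an infinitely near point [q] is one of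
    [F]: the divisor over [q] is a part of the divisor over [p]
    ([tangent_saddle_node_cat]).  Conversely, if [chi_p = 0] and [nu_p > 1],
    then [xi_p = 0]; but each tangent saddle-node [q] contributes
    [nu(D_q) (Ind_q - 1) > 0] to [xi_p], so that there is none
    ([tangency_excess_gt0]).

    Both arguments need that the sums are finite, a sum with infinite support
    being [0] by convention, and that [nu(D_q)] is positive.

    - Finiteness of [I_p] ([finite_near]).  A point of [I_p] is the base point
      or lies on the exceptional line of the blow-up of a center.  There are
      finitely many centers by assumption, and it remains to see that the
      exceptional line of a blow-up has finitely many points that are singular
      relative to the divisor.  In the chart [y = x (y' + c)] the pullback of a
      1-form is the sum of the [x^i (A_i(y' + c) dx + B_i(y' + c) dy')], for
      polynomials [A_i] and [B_i] that do not depend on [c].  If [m] is the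
      least index such that [A_m] or [B_m] is nonzero, then the strict
      transform at [c] starts with [A_m(y' + c) dx + B_m(y' + c) dy'].  Either
      [B_m] is nonzero, and the leaf through [c] is transverse to the line
      unless [B_m(c) = 0] (the dicritical case), or [B_m = 0], and the leaf
      through [c] is the line itself unless [A_m(c) = 0]
      ([D_singular_root]).

    - Positivity of [nu(D_q)] ([component_mult_gt0]).  The multiplicity of a
      parametrized curve is positive unless its image at [p] is a single point,
      that is unless one of the blow-downs contracts it, and a blow-down
      contracts only the curves in the exceptional line.  A curve that is
      transverse to a component outside the corners is not contained in the
      divisor ([curve_at_base_neq0]). *)

(** * Least elements and power series in one variable *)

Lemma nat_leastP (S : set nat) : (exists n, S n) ->
  S (nat_least S) /\ forall m, S m -> (nat_least S <= m)%N.
Proof.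
move=> exS; apply: (@xgetPex _ _ [set n | S n /\ forall m, S m -> (n <= m)%N]).
have exb : exists n, `[< S n >] by case: exS => n Sn; exists n; apply/asboolP.
case: (ex_minnP exb) => n /asboolP Sn minn; exists n; split=> // m Sm.
by apply: minn; apply/asboolP.
Qed.

Lemma nat_least_gt0 (S : set nat) : (exists n, S n) -> ~ S 0%N ->
  (0 < nat_least S)%N.
Proof.
move=> /nat_leastP[Sl _] nS0; rewrite lt0n; apply/eqP => l0.
by rewrite l0 in Sl.
Qed.

Section FpsFacts.
Variable A : comNzRingType.
Implicit Types a b : fps A.

Lemma coef_fpsM a b n :
  coef (a * b) n = \sum_(j < n.+1) coef a j * coef b (n - j)%N.
Proof. by []. Qed.

Lemma coef_constM x a n : coef (fps_const x * a) n = x * coef a n.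
Proof.
rewrite coef_fpsM big_ord_recl /= subn0 big1 ?addr0 // => i _.
by rewrite mulr0n mul0r.
Qed.

Lemma coef_varM a n :
  coef (fps_var A * a) n = if n is n'.+1 then coef a n' else 0.
Proof.
rewrite coef_fpsM; case: n => [|n]; first by rewrite big_ord1 mul0r.
rewrite !big_ord_recl /= mul0r add0r subSS subn0 mul1r big1 ?addr0 // => i _.
by rewrite mul0r.
Qed.

Lemma fps_neq0 a : a != 0 -> exists n, coef a n != 0.
Proof.
apply: contra_neqP => /forallNP a0; apply: fpsP => n.
by apply/eqP; have /negP := a0 n; rewrite negbK.
Qed.

Lemma coef_neq0 a n : coef a n != 0 -> a != 0.
Proof. by apply: contraNneq => ->. Qed.

End FpsFacts.

Lemma fps_mulf_neq0 (K : fieldType) (a b : fps K) :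
  a != 0 -> b != 0 -> a * b != 0.
Proof.
move=> /fps_neq0/nat_leastP; set m := nat_least _ => -[am minm].
move=> /fps_neq0/nat_leastP; set n := nat_least _ => -[bn minn].
apply: (@coef_neq0 _ _ (m + n)); rewrite coef_fpsM.
have ltm : (m < (m + n).+1)%N by rewrite ltnS leq_addr.
rewrite (bigD1 (Ordinal ltm)) //= addKn big1 ?addr0 ?mulf_neq0 // => i.
rewrite -val_eqE /= neq_ltn => /orP[lt_im|lt_mi].
  suff /eqP-> : coef a i == 0 by rewrite mul0r.
  by apply: contraTT lt_im => ai; rewrite -leqNgt minm.
suff /eqP-> : coef b (m + n - i)%N == 0 by rewrite mulr0.
have : ((m + n) - i < n)%N.
  by rewrite ltn_subLR ?ltn_add2r // -ltnS.
by apply: contraTT => bi; rewrite -leqNgt minn.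
Qed.

(** * The blow-up in an affine chart *)

Section Foliations.
Variable K : fieldType.
Local Notation fps2 := (fps (fps K)).
Implicit Types (f : fps2) (w : oneform K) (q : point K) (c : K).

Lemma coef2D f g i j : coef2 (f + g) i j = coef2 f i j + coef2 g i j.
Proof. by []. Qed.

Lemma coef2_cstM c f i j : coef2 (cst c * f) i j = c * coef2 f i j.
Proof. by rewrite /coef2 coef_constM coef_constM. Qed.

Lemma coef2_varxM f i j :
  coef2 (varx K * f) i j = if i is i'.+1 then coef2 f i' j else 0.
Proof. by rewrite /coef2 coef_constM coef_varM. Qed.

Lemma coef2_varyM f i j :
  coef2 (vary K * f) i j = if j is j'.+1 then coef2 f i j' else 0.
Proof. by rewrite /coef2 coef_varM; case: j. Qed.

Lemma coef2_varxXM n f i j :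
  coef2 (varx K ^+ n * f) i j = if (n <= i)%N then coef2 f (i - n) j else 0.
Proof.
elim: n i => [|n IHn] i; first by rewrite expr0 mul1r subn0.
by rewrite exprS -mulrA coef2_varxM; case: i => [|i] //; rewrite IHn.
Qed.

Lemma coef2_linX c l i j :
  coef2 ((vary K + cst c) ^+ l) i j =
  if i == 0%N then (('X + c%:P) ^+ l)`_j else 0.
Proof.
elim: l i j => [|l IHl] i j.
  by rewrite !expr0 coef1 /coef2 /=; case: j; case: i.
rewrite !exprS mulrDl coef2D coef2_varyM coef2_cstM mulrDl coefD coefXM coefCM.
by case: j => [|j]; rewrite /= !IHl; case: i => //=; rewrite mulr0 addr0.
Qed.

(** The homogeneous part of degree [i] of [f], evaluated at [(1, y)]. *)
Definition hom_part f (i : nat) : {poly K} :=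
  \sum_(l < i.+1) coef2 f (i - l) l *: 'X^l.

Lemma coef_hom_part f i l : (l <= i)%N -> (hom_part f i)`_l = coef2 f (i - l) l.
Proof.
move=> le_li; have lt_li : (l < i.+1)%N by [].
rewrite /hom_part coef_sum (bigD1 (Ordinal lt_li)) //= coefZ coefXn eqxx mulr1.
rewrite big1 ?addr0 // => k; rewrite -val_eqE eq_sym /= => /negPf nk.
by rewrite coefZ coefXn nk mulr0.
Qed.

(** Under [y = x (y' + c)], a form of degree [i] becomes [x^i] times its
    value at [(1, y' + c)]: the coefficient of [x^i] comes from the part of
    degree [i] only. *)
Lemma coef2_blowup f c i j :
  coef2 (fps2_comp f (varx K) (varx K * (vary K + cst c))) i j =
  (hom_part f i \Po ('X + c%:P))`_j.
Proof.
have coefE k l : coef2 (varx K ^+ k * (varx K * (vary K + cst c)) ^+ l) i j =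
    if (k + l == i)%N then (('X + c%:P) ^+ l)`_j else 0.
  rewrite exprMn mulrA -exprD coef2_varxXM coef2_linX subn_eq0.
  by rewrite eqn_leq; case: (_ <= i)%N.
have -> : coef2 (fps2_comp f (varx K) (varx K * (vary K + cst c))) i j =
    \sum_(k < (i + j).+1) \sum_(l < (i + j).+1)
      coef2 f k l * (if (k + l == i)%N then (('X + c%:P) ^+ l)`_j else 0).
  by apply: eq_bigr => k _; apply: eq_bigr => l _; rewrite coefE.
rewrite exchange_big /=.
(* Only the monomials of degree exactly i contribute. *)
pose G l := if (l < i.+1)%N then coef2 f (i - l) l * (('X + c%:P) ^+ l)`_j else 0.
transitivity (\sum_(l < (i + j).+1) G l).
  apply: eq_bigr => l _; rewrite /G ltnS; case: leqP => [le_li|lt_il].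
    have lt_k : (i - l < (i + j).+1)%N.
      by rewrite ltnS (leq_trans (leq_subr _ _)) ?leq_addr.
    rewrite (bigD1 (Ordinal lt_k)) //= subnK // eqxx big1 ?addr0 // => k.
    rewrite -val_eqE /=; case: (k + l =P i)%N => [ki /eqP[]|_ _].
      by apply/eqP; rewrite -(eqn_add2r l) subnK //; apply/eqP.
    by rewrite mulr0.
  rewrite big1 // => k _; case: (k + l =P i)%N => [ki|_]; last by rewrite mulr0.
  by have := leq_addl k l; rewrite ki leqNgt lt_il.
rewrite -big_mkcond /= -(big_ord_widen _
  (fun l => coef2 f (i - l) l * (('X + c%:P) ^+ l)`_j)) ?ltnS ?leq_addr //.
rewrite /hom_part raddf_sum coef_sum; apply: eq_bigr => l _ /=.
by rewrite comp_polyZ comp_Xn_poly coefZ.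
Qed.

Lemma hom_part_eq0 f : (forall i, hom_part f i = 0) -> f = 0.
Proof.
move=> f0; apply: fpsP => j; apply: fpsP => i; rewrite -[LHS]/(coef2 f i j).
by have := coef_hom_part f (leq_addl i j); rewrite addnK f0 coef0 => <-.
Qed.

(** Since [dy = (y' + c) dx + x dy'], the pullback of [P dx + Q dy] has the
    coefficients [P + (y' + c) Q] and [x Q]: this is where the factor ['X] and
    the shift of the degree come from. *)
Definition dx_part w i : {poly K} := hom_part w.1 i + 'X * hom_part w.2 i.
Definition dy_part w i : {poly K} := if i is i'.+1 then hom_part w.2 i' else 0.

Lemma derx_varx : derx (varx K) = 1.
Proof.
apply: fpsP => j; apply: fpsP => i.
rewrite -[LHS]/(coef2 (varx K) i.+1 j *+ i.+1) /coef2 /=.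
by case: j => [|j] /=; case: i => [|i]; rewrite /= ?mul0rn.
Qed.

Lemma dery_varx : dery (varx K) = 0.
Proof.
apply: fpsP => j; apply: fpsP => i.
by rewrite -[LHS]/(coef2 (varx K) i j.+1 *+ j.+1) /coef2 /= mul0rn.
Qed.

Lemma derx_chart c : derx (varx K * (vary K + cst c)) = vary K + cst c.
Proof.
apply: fpsP => j; apply: fpsP => i.
rewrite -[LHS]/(coef2 (varx K * (vary K + cst c)) i.+1 j *+ i.+1).
rewrite coef2_varxM -[RHS]/(coef2 (vary K + cst c) i j) -[vary K + _]expr1.
by rewrite coef2_linX; case: i => [|i]; rewrite ?mulr1n ?mul0rn.
Qed.

Lemma dery_chart c : dery (varx K * (vary K + cst c)) = varx K.
Proof.
apply: fpsP => j; apply: fpsP => i.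
rewrite -[LHS]/(coef2 (varx K * (vary K + cst c)) i j.+1 *+ j.+1).
rewrite coef2_varxM -[RHS]/(coef2 (varx K) i j) -[vary K + _]expr1.
rewrite -[varx K]mulr1 coef2_varxM; case: i => [|i]; first by rewrite mul0rn.
rewrite coef2_linX expr1 coefD coefX coefC addr0 /coef2 /=.
by case: i => [|i]; case: j => [|j]; rewrite /= ?mul0rn.
Qed.

Lemma pullback_blowup w c i j :
  (coef2 (pullback (blowup (Some c)) w).1 i j =
     (dx_part w i \Po ('X + c%:P))`_j) *
  (coef2 (pullback (blowup (Some c)) w).2 i j =
     (dy_part w i \Po ('X + c%:P))`_j).
Proof.
rewrite /pullback /blowup /= derx_varx dery_varx derx_chart dery_chart.
split.
  rewrite mulr1 [fps2_comp w.2 _ _ * _]mulrC mulrDl !coef2D coef2_varyM.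
  rewrite coef2_cstM !coef2_blowup comp_polyD coefD; congr (_ + _).
  rewrite comp_polyM comp_polyX mulrDl coefD coefXM coefCM.
  by case: j => [|j]; rewrite /= ?coef2_blowup.
rewrite mulr0 add0r mulrC coef2_varxM; case: i => [|i] /=.
  by rewrite comp_poly0 coef0.
by rewrite coef2_blowup.
Qed.

(** The power of the exceptional line that is divided out: the order of the
    1-form, plus one if the blow-up is dicritical.  It is defined without the
    direction [c], which is what makes the polynomial of [D_singular_root]
    the same for all [c]. *)
Definition pullback_order w : nat :=
  nat_least [set m | dx_part w m != 0 \/ dy_part w m != 0]%classic.

Lemma pullback_orderP w : w <> (0, 0) ->
  dx_part w (pullback_order w) != 0 \/ dy_part w (pullback_order w) != 0.
Proof.
move=> w0; suff /nat_leastP[] : exists m, dx_part w m != 0 \/ dy_part w m != 0 by [].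
apply: contrapT => /forallNP part0.
have dx0 i : dx_part w i = 0.
  by apply/eqP; apply: contrapT => /negP n0; apply: (part0 i); left.
have Q0 : w.2 = 0.
  apply: hom_part_eq0 => i; apply/eqP; apply: contrapT => /negP n0.
  by apply: (part0 i.+1); right.
have P0 : w.1 = 0.
  apply: hom_part_eq0 => i; have := dx0 i; rewrite /dx_part Q0.
  suff -> : hom_part (0 : fps2) i = 0 by rewrite mulr0 addr0.
  by rewrite /hom_part big1 // => l _; apply: scale0r.
by case: w w0 Q0 P0 {part0 dx0} => P Q /= w0 Q0 P0; apply: w0; rewrite P0 Q0.
Qed.

Lemma strict_transform_affine w c i j :
  let m := (i + pullback_order w)%N in
  (coef2 (strict_transform w (Some c)).1 i j =
     (dx_part w m \Po ('X + c%:P))`_j) *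
  (coef2 (strict_transform w (Some c)).2 i j =
     (dy_part w m \Po ('X + c%:P))`_j).
Proof.
(* Translating by c does not change which parts vanish. *)
have shift0 (p : {poly K}) :
    (exists j, (p \Po ('X + c%:P))`_j != 0) <-> p != 0.
  have size2 : (1 < size ('X + c%:P)%R)%N by rewrite size_XaddC.
  rewrite -(comp_poly_eq0 p size2); split=> [[k]|nz].
    by apply: contraNneq => ->; rewrite coef0.
  by exists (size (p \Po ('X + c%:P))).-1; rewrite -lead_coefE lead_coef_eq0.
rewrite /strict_transform; set S := [set m | exists j, _]%classic.
have -> : nat_least S = pullback_order w.
  congr nat_least; apply/seteqP; split=> m /=.
    move=> [k]; rewrite !(pullback_blowup w).
    by move=> [nz|nz]; [left|right]; apply/shift0; exists k.
  move=> [/shift0[k nz]|/shift0[k nz]]; exists k; rewrite !(pullback_blowup w).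
    by left.
  by right.
split; first exact: (pullback_blowup w c _ j).1.
exact: (pullback_blowup w c _ j).2.
Qed.

Lemma horner_shift (p : {poly K}) c : (p \Po ('X + c%:P))`_0 = p.[c].
Proof. by rewrite -horner_coef0 horner_comp !hornerE. Qed.

(** The points of the exceptional line that are singular relative to the
    divisor are roots of the leading [dy] part (dicritical case) or, if it
    vanishes, of the leading [dx] part (the line is then invariant).  The
    direction [c = 0] is left out because the point may be a corner there. *)
Lemma D_singular_root w q : foliation_at w q <> (0, 0) ->
  exists2 p : {poly K}, p != 0 &
    forall c, c != 0 -> D_singular w (Some c :: q) -> root p c.
Proof.
move=> wq0; have := pullback_orderP wq0; set v := foliation_at w q in wq0 *.
set m := pullback_order v => nz.
exists (if dy_part v m == 0 then dx_part v m else dy_part v m).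
  by move: nz; case: (dy_part v m =P 0) => [_ [] | /eqP].
move=> c c0; apply: contraPT => nroot.
rewrite /D_singular /= -/v; set u := strict_transform v (Some c).
have u1 : coef2 u.1 0 0 = (dx_part v m).[c].
  by rewrite strict_transform_affine add0n horner_shift.
have u2 j : coef2 u.2 0 j = (dy_part v m \Po ('X + c%:P))`_j.
  by rewrite strict_transform_affine add0n.
have nY : in_divisor (Some c :: q) AxisY = false.
  by rewrite /in_divisor /= (negPf c0).
have [|dy0] := boolP (dy_part v m == 0); move: nroot; last first.
  (* The leaf is transverse to the exceptional line. *)
  rewrite (negPf dy0) rootE -horner_shift -u2 => u20.
  move=> [[_ /eqP]|[_ []]]; first exact/negP.
  split; last by rewrite /corner nY andbF.
  by case=> [_|]; [right | rewrite nY].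
(* The leaf is the exceptional line. *)
move=> nroot dy0; rewrite dy0 rootE -u1 in nroot.
move=> [[/eqP u10 _]|[_ []]]; first by rewrite u10 in nroot.
split; last by rewrite /corner nY andbF.
case=> [_|]; last by rewrite nY.
left; exists (Fps2 (fun i j => coef2 u.2 i.+1 j)).
apply: fpsP => j; apply: fpsP => i.
rewrite -[LHS]/(coef2 u.2 i j) -[RHS]/(coef2 (varx K * _) i j) coef2_varxM.
by case: i => [|i] //; rewrite u2 (eqP dy0) comp_poly0 coef0.
Qed.


Lemma finite_root (p : {poly K}) : p != 0 -> finite_set [set c | root p c]%classic.
Proof.
have [n] := ubnP (size p); elim: n p => // n IHn p lt_pn p0.
have [/existsNP[c /contrapT pc]|noroot] := pselect (~ forall c, ~ root p c); last first.
  apply: sub_finite_set (finite_set0 K) => c /= pc.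
  by move/contrapT: noroot => /(_ c).
have [q Dp] := factor_theorem _ _ pc.
have q0 : q != 0 by apply: contraNneq p0 => q0; rewrite Dp q0 mul0r.
apply: (@sub_finite_set _ _ ([set c | root q c] `|` [set c])%classic).
  by move=> d /=; rewrite Dp rootM root_XsubC => /orP[|/eqP]; [left|right].
rewrite finite_setU; split; last exact: finite_set1.
apply: IHn => //; move: lt_pn.
by rewrite Dp size_Mmonic ?monicXsubC // size_XsubC addn2 ltnS.
Qed.

Lemma finite_D_singular w q : foliation_at w q <> (0, 0) ->
  finite_set [set e | D_singular w (e :: q)]%classic.
Proof.
move=> /D_singular_root[p p0 Dp].
apply: (@sub_finite_set _ _
  ([set None; Some 0] `|` Some @` [set c | root p c])%classic).
  move=> [c|] /= Dc; last by left; left.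
  have [->|c0] := eqVneq c 0; first by left; right.
  by right; exists c => //; apply: Dp.
rewrite finite_setU; split; first exact: finite_set2.
exact/finite_image/finite_root.
Qed.

(** * Finiteness of the set of infinitely near points *)
Lemma strict_transform0 e : strict_transform (0, 0) e = (0, 0) :> oneform K.
Proof.
have comp0 g h : fps2_comp (0 : fps2) g h = 0.
  apply: fpsP => j; apply: fpsP => i /=.
  by rewrite big1 // => k _; rewrite big1 // => l _; apply: mul0r.
have pull0 (phi : formal_map K) : pullback phi (0, 0) = (0, 0).
  by rewrite /pullback /= !comp0 !mul0r addr0.
by rewrite /strict_transform pull0; case: e => [c|];
  congr pair; apply: fpsP => j; apply: fpsP => i.
Qed.

Lemma not_reduced0 : ~ reduced ((0, 0) : oneform K).
Proof.
move=> [_ /eqP[]]; apply/matrixP => i j; rewrite !mxE.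
by case: (i == 0); case: (j == 0); rewrite /= /coef2 /= ?oppr0.
Qed.


Section Process.
Hypothesis infK : infinite_set [set: K].
Variables (w : oneform K) (pi : reduction_process w).

Lemma center_in_process q : is_center w q -> q \in centers pi.
Proof.
case; elim=> [Ds|e {}q near IHq nred Ds] nredq;
  apply: contra_notT nredq => qNc; apply: (final_reduced qNc) => //.
  by left.
by right; apply: IHq.
Qed.

Lemma finite_affine_centers q : finite_set [set c | is_center w (Some c :: q)]%classic.
Proof.
pose slope (r : point K) := if r is Some c :: _ then c else 0.
apply: (@sub_finite_set _ _ (slope @` [set` centers pi])%classic).
  by move=> c /center_in_process inc; exists (Some c :: q).
exact/finite_image/finite_seq.
Qed.

(** If the strict transform vanished at [q], it would vanish at all the points
    of the exceptional line of the blow-up of [q].  All of them would then be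
    non-reduced singular points, hence centers, but there are finitely many
    centers. *)
Lemma near_neq0 q : infinitely_near w q -> foliation_at w q <> (0, 0).
Proof.
move=> near wq0; apply: infK; apply: sub_finite_set (finite_affine_centers q).
move=> c _ /=.
have wc0 : foliation_at w (Some c :: q) = (0, 0).
  by rewrite -(strict_transform0 (Some c)) -wq0.
split; last by rewrite wc0; apply: not_reduced0.
apply: Near_blowup => //; first by rewrite wq0; apply: not_reduced0.
by left; rewrite wc0.
Qed.

(** The points of [I_p] other than the base point are found on the exceptional
    lines of the blow-ups of the finitely many centers. *)
Lemma finite_near : finite_set [set q | infinitely_near w q]%classic.
Proof.
pose children q := [set e | infinitely_near w q /\ D_singular w (e :: q)]%classic.
apply: (@sub_finite_set _ _ ([set [::]] `|`
  \bigcup_(q in [set` centers pi]) (cons^~ q @` children q))%classic).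
  move=> q /=; case=> [_|e {}q near nred Ds]; first by left.
  right; exists q; first exact: center_in_process.
  by exists e.
rewrite finite_setU; split; first exact: finite_set1.
apply: bigcup_finite => [|q _]; first exact: finite_seq.
apply: finite_image; have [near|nnear] := pselect (infinitely_near w q).
  by apply: sub_finite_set (finite_D_singular (near_neq0 near)) => e [].
by apply: sub_finite_set (finite_set0 _) => e [].
Qed.

End Process.

(** * Multiplicity of the components of the divisor *)

Lemma curve_at_base_coef0 q (g : curve K) :
  coef g.1 0 = 0 -> coef g.2 0 = 0 ->
  coef (curve_at_base q g).1 0 = 0 /\ coef (curve_at_base q g).2 0 = 0.
Proof.
elim: q g => [|[c|] q IHq] g g1 g2 //=; apply: IHq; rewrite //= big_ord1.
  by rewrite g1 mul0r.
by rewrite g1 mul0r.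
Qed.

(** A blow-down maps the curve to [(a, a (b + c))] or [(a b, b)].  That the
    curve lies on none of the branches of the divisor through its point
    persists after the blow-down, and at the next step it ensures that
    neither of these products vanishes. *)
Lemma curve_at_base_neq0 q (g : curve K) :
    coef g.1 0 = 0 -> coef g.2 0 = 0 ->
    (in_divisor q AxisX -> g.1 != 0) -> (in_divisor q AxisY -> g.2 != 0) ->
    g.1 != 0 \/ g.2 != 0 ->
  (curve_at_base q g).1 != 0 \/ (curve_at_base q g).2 != 0.
Proof.
elim: q g => [|[c|] q IHq] g g1 g2 //= nzX nzY _; apply: IHq => /=.
- by [].
- by rewrite big_ord1 g1 mul0r.
- by move=> _; apply: nzX.
- move=> divY; apply: fps_mulf_neq0; first exact: nzX.
  (* For c = 0, the branch {y = 0} of the divisor passes through the point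
     before the blow-down as well; for c <> 0, the constant term is c. *)
  have [c0|c0] := eqVneq c 0.
    apply: contraNneq (nzY _) => [g0|]; last by rewrite /in_divisor /= c0 eqxx.
    apply/eqP; apply: fpsP => n; have := congr1 (fun a : fps K => coef a n) g0.
    by rewrite /= c0 mul0rn addr0.
  by apply: (@coef_neq0 _ _ 0); rewrite /= g2 add0r.
- by left; apply: nzX.
- by rewrite big_ord1 g1 mul0r.
- by [].
- by move=> divX; apply: fps_mulf_neq0; [apply: nzX | apply: nzY].
- by move=> _; apply: nzY.
- by right; apply: nzY.
Qed.

Lemma transverse_curve_mult_gt0 e r (g : curve K) :
  ~~ corner (e :: r) -> transverse_curve e g ->
  (0 < curve_mult (curve_at_base (e :: r) g))%N.
Proof.
move=> ncor [g1 g2 ord1]; apply: nat_least_gt0; last first.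
  have [h1 h2] := curve_at_base_coef0 (e :: r) g1 g2.
  by case; rewrite ?h1 ?h2 eqxx.
have [|||/fps_neq0[n hn]|/fps_neq0[n hn]] :=
  @curve_at_base_neq0 (e :: r) g g1 g2; last 2 first.
- by exists n; left.
- by exists n; right.
- case: e ncor ord1 => [c|]; first by move=> _ /coef_neq0.
  by rewrite /corner andbC => /nandP[|/negPf-> //].
- case: e ncor ord1 => [c|]; last by move=> _ /coef_neq0.
  by rewrite /corner => /nandP[|/negPf-> //].
- by case: e ord1 {ncor} => [c|] /coef_neq0; [left|right].
Qed.

(** As the field is infinite, the new component has points that are neither
    corners nor centers, so that [nu(D_r)] is not a default value. *)
Lemma component_mult_gt0 w (pi : reduction_process w) (r : point K) :
  infinite_set [set: K] -> (0 < component_mult w r)%N.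
Proof.
move=> infK; rewrite /component_mult; set S := (X in xget _ X).
suff /(@xgetPex _ 0%N)[e [g [ncor _ tr ->]]] : exists n, S n.
  exact: transverse_curve_mult_gt0.
have fin : finite_set ([set 0] `|` [set c | is_center w (Some c :: r)])%classic.
  rewrite finite_setU; split; first exact: finite_set1.
  exact: finite_affine_centers.
have [c [_ /= /not_orP[c0 nc]]] := infinite_setN0 (infinite_setD infK fin).
pose g : curve K := (fps_var K, 0).
exists (curve_mult (curve_at_base (Some c :: r) g)), (Some c), g; split=> //.
  by rewrite /corner /in_divisor /=; case: eqP => // /c0.
by split; rewrite //= oner_eq0.
Qed.

(** * Tangent saddle-nodes over infinitely near points *)

Lemma foliation_at_cat w q q' :
  foliation_at w (q' ++ q) = foliation_at (foliation_at w q) q'.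
Proof.
elim: q' => [|e q' IHq]; first by [].
by rewrite /= IHq; reflexivity.
Qed.

Lemma divisor_cat q q' b r :
  divisor q' b = Some r -> divisor (q' ++ q) b = Some (r ++ q).
Proof.
elim: q' b => [|[c|] q' IHq] [] //=; try by case=> <-.
  by case: eqP => // _; apply: IHq.
exact: IHq.
Qed.

Lemma in_divisor_cat q q' b : in_divisor q' b -> in_divisor (q' ++ q) b.
Proof.
by rewrite /in_divisor; case E: (divisor q' b) => [r|] // _; rewrite (divisor_cat q E).
Qed.

(** The divisor over [p] contains the divisor over [q], and normal crossings
    with the larger divisor implies normal crossings with the smaller one. *)
Lemma D_singular_cat w q q' :
  D_singular (foliation_at w q) q' -> D_singular w (q' ++ q).
Proof.
rewrite /D_singular foliation_at_cat => -[sing|[nsing ncross]]; [by left|right].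
split=> //; apply: contra_not ncross => -[cr1 cr2]; split=> [b div|].
  exact/cr1/in_divisor_cat.
by move=> /andP[dX dY]; apply: cr2; rewrite /corner !in_divisor_cat.
Qed.

Lemma near_cat w q q' : infinitely_near w q ->
  infinitely_near (foliation_at w q) q' -> infinitely_near w (q' ++ q).
Proof.
move=> near; elim=> // e {}q' _ IHq nred /D_singular_cat Ds.
by apply: Near_blowup => //; rewrite foliation_at_cat.
Qed.

Lemma tangent_saddle_node_cat w q q' : infinitely_near w q ->
  tangent_saddle_node (foliation_at w q) q' -> tangent_saddle_node w (q' ++ q).
Proof.
move=> near [r [near' red [b [div weak]]]]; exists (r ++ q).
split; first exact: near_cat.
  by rewrite foliation_at_cat.
by exists b; rewrite foliation_at_cat; split=> //; apply: divisor_cat.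
Qed.

Lemma second_type_near w q : infinitely_near w q -> second_type w ->
  second_type (foliation_at w q).
Proof. by move=> near st q' /(tangent_saddle_node_cat near); apply: st. Qed.

(** * The tangency excess and the chi-number *)

Lemma tangency_excess_second_type w : second_type w -> tangency_excess w = 0%N.
Proof.
move=> st; rewrite /tangency_excess; case: ifP => // _.
by apply: fsbig1 => q /= /st.
Qed.

Lemma near_reduced w q : reduced w -> infinitely_near w q -> q = [::].
Proof. by move=> red; elim=> // e {}q _ -> /(_ red). Qed.

(** No component of the divisor passes through the base point, which is the
    only point of [I_p] for a reduced germ.  This matters because [xi_p = 0]
    holds by definition in that case. *)
Lemma reduced_second_type w : reduced w -> second_type w.
Proof.
by move=> red q [r [near _ [b [+ _]]]]; rewrite (near_reduced red near); case: b.
Qed.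

(** [Ind = k + 1] with [k > 0] in every normal form, so that the arbitrary
    choice of one in [weak_index] is harmless. *)
Lemma weak_index_gt1 w b : weak_separatrix w b -> (1 < weak_index w)%N.
Proof.
move=> [_ [k [phi [norm _]]]]; rewrite /weak_index; set S := (X in xget _ X).
suff /(@xgetPex _ 0%N)[k' [phi' [[k0 _ _] ->]]] : exists n, S n by [].
by exists k.+1, k, phi.
Qed.


Lemma tangency_excess_gt0 w (pi : reduction_process w) q :
  infinite_set [set: K] -> tangent_saddle_node w q ->
  (0 < tangency_excess w)%N.
Proof.
move=> infK tan; rewrite /tangency_excess; case: asboolP => [red|_].
  by case: (reduced_second_type red tan).
rewrite (fsbigD1 q) //; last first.
  by apply: sub_finite_set (finite_near infK pi) => r [? []].
apply: ltn_addr; rewrite muln_gt0 component_mult_gt0 //= subn_gt0.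
by have [r [_ _ [b [_ /weak_index_gt1]]]] := tan.
Qed.

Lemma alg_mult_gt0 w : w <> (0, 0) -> singular w -> (0 < alg_mult w)%N.
Proof.
move=> w0 [P00 Q00]; apply: nat_least_gt0.
  apply: contrapT => /forallNP coef0; apply: w0.
  case: w coef0 {P00 Q00} => P Q coef0.
  by congr pair; apply: fpsP => j; apply: fpsP => i;
    apply/eqP; apply: contrapT => /negP nz; apply: (coef0 (i + j)%N);
    exists i, j; split=> //; [left|right].
move=> [i [j [/eqP]]]; rewrite addn_eq0 => /andP[/eqP-> /eqP->].
by rewrite P00 Q00 eqxx => -[].
Qed.

Definition higher_excess w : nat :=
  \big[addn/0%N]_(q \in [set q | infinitely_near w q] `\ [::])
     (alg_mult (foliation_at w q) * tangency_excess (foliation_at w q))%N.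

Lemma chi_numberE w (pi : reduction_process w) :
  infinite_set [set: K] -> singular w ->
  chi_number w = ((alg_mult w).-1 * tangency_excess w + higher_excess w)%:Z.
Proof.
move=> infK sing.
have near0 : infinitely_near w [::] by apply: Near_base; left.
have nu_gt0 := alg_mult_gt0 (near_neq0 infK pi near0) sing.
rewrite /chi_number (fsbigD1 [::]) //; last exact: finite_near.
rewrite /= -{1}(prednK nu_gt0) mulSn -/(higher_excess w).
by rewrite -addnA PoszD addrC addKr.
Qed.

Lemma chi_second_type w (pi : reduction_process w) :
  infinite_set [set: K] -> singular w -> second_type w -> chi_number w = 0.
Proof.
move=> infK sing st; rewrite (chi_numberE pi infK sing).
rewrite tangency_excess_second_type // muln0 /higher_excess fsbig1 // => q [near _].
by rewrite tangency_excess_second_type ?muln0 //; apply: second_type_near.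
Qed.

Lemma chi_eq0 w (pi : reduction_process w) :
  infinite_set [set: K] -> singular w -> chi_number w = 0 ->
  (alg_mult w <= 1)%N \/ second_type w.
Proof.
move=> infK sing; rewrite (chi_numberE pi infK sing) => /eqP.
rewrite eqz_nat addn_eq0 muln_eq0 -subn1 subn_eq0 => /andP[/orP[]]; first by left.
move=> /eqP xi0; right=> q /(tangency_excess_gt0 pi infK).
by rewrite xi0.
Qed.

End Foliations.

Lemma infinite_numField (K : numFieldType) : infinite_set [set: K].
Proof.
move=> finK; apply: infinite_nat.
have inj : {in [set: nat] &, injective (fun n => n%:R : K)}%classic.
  by move=> m n _ _; apply: mulrIn; apply: oner_neq0.
have /eq_finite_set <- := inj_card_eq inj.
exact: sub_finite_set finK.
Qed.

Theorem proposition3p1 (R : realType) (F : oneform (complex R))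
    (hF : singular_foliation F) (pi : reduction_process F) :
  [/\ 0 <= chi_number F,
      second_type F -> chi_number F = 0,
      chi_number F = 0 -> alg_mult F = 1%N \/ second_type F &
      (1 < alg_mult F)%N -> (chi_number F = 0 <-> second_type F)].
Proof.
have [_ sing] := hF.
have infC : infinite_set [set: complex R] := @infinite_numField (complex R).
have near0 : infinitely_near F [::] by apply: Near_base; left.
have nu_gt0 := alg_mult_gt0 (near_neq0 infC pi near0) sing.
have chi0 := chi_eq0 pi infC sing.
split.
- by rewrite (chi_numberE pi infC sing).
- exact: chi_second_type.
- move=> /chi0[nu_le1|]; [left | by right].
  by apply/eqP; rewrite eqn_leq nu_le1.
- move=> nu_gt1; split=> [/chi0[|//]|]; first by rewrite leqNgt nu_gt1.
  exact: chi_second_type.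
Qed.
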